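(* Let $G$ be an AG-group, let $\nu\in F(G)$ be a fuzzy AG-subgroup of $G$, and let $H$ be any AG-subgroup of $G$. Define a fuzzy subset $\xi$ of $G/H$ by $\xi(Hx)=\vee\{\nu(z) : z\in Hx\}$ for all $x\in G$. Then $\xi\in F(G/H)$, i.e. $\xi$ is a fuzzy AG-subgroup of the quotient AG-group $G/H$.
   Context: An AG-group is a set $G$ with a binary operation (written as juxtaposition) satisfying the left invertive law $(ab)c=(cb)a$ for all $a,b,c\in G$, such that there is a unique left identity $e\in G$ ($ea=a$ for all $a\in G$) and for every $a\in G$ there is $a^{-1}\in G$ with $a^{-1}a=aa^{-1}=e$. The operation need not be associative or commutative. An AG-subgroup of $G$ is a nonempty subset that is itself an AG-group under the operation of $G$. For an AG-subgroup $H$ of $G$, let $Hx=\{hx : h\in H\}$; the quotient $G/H=\{Hx : x\in G\}$ is an AG-group under $(Hx)(Hy)=H(xy)$ (known for every AG-subgroup $H$, with no normality assumption). A fuzzy subset of a set $X$ is a map $X\to[0,1]$. Write $s\wedge t=\min(s,t)$, and $\vee$ for supremum. For an AG-group $K$, a fuzzy subset $\mu$ of $K$ is a fuzzy AG-subgroup of $K$ (written $\mu\in F(K)$) if for all $x,y\in K$: $\mu(xy)\ge\mu(x)\wedge\mu(y)$ and $\mu(x^{-1})\ge\mu(x)$. *)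

(* Defs.v *)
From HB Require Import structures.
From mathcomp Require Import all_boot all_order all_algebra.
From mathcomp Require Import all_classical all_reals.

Set Implicit Arguments.
Unset Strict Implicit.
Unset Printing Implicit Defensive.
Import Order.TTheory GRing.Theory Num.Theory.
Local Open Scope classical_set_scope.

(* "The subset A of T is an AG-group under op"; used with A = setT for an
   AG-group and with a nonempty A for an AG-subgroup. *)
Record AGgroup_on (T : Type) (op : T -> T -> T) (A : set T) : Prop := {
  AGgroup_closed : forall a b, A a -> A b -> A (op a b);
  AGgroup_left_invertive : forall a b c, A a -> A b -> A c ->
    op (op a b) c = op (op c b) a;
  AGgroup_unit_inverse : exists e,
    [/\ A e,
        forall a, A a -> op e a = a,
        forall f, A f -> (forall a, A a -> op f a = a) -> f = e
      & forall a, A a -> exists b, [/\ A b, op b a = e & op a b = e]] }.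

HB.mixin Record isAGGroup T := {
  agmul : T -> T -> T;
  agmulP : AGgroup_on agmul [set: T]
}.

#[short(type="agGroupType")]
HB.structure Definition AGGroup := { T of isAGGroup T }.

Declare Scope ag_scope.
Delimit Scope ag_scope with AG.
Notation "x * y" := (agmul x y) : ag_scope.
Local Open Scope ag_scope.

Definition age (G : agGroupType) : G :=
  sval (cid (AGgroup_unit_inverse (@agmulP G))).

Section AGGroupTheory.
Variable G : agGroupType.
Implicit Types a b c d f : G.

Lemma ageP : [/\ forall a, age G * a = a,
  forall f, (forall a, f * a = a) -> f = age G
  & forall a, exists b, b * a = age G /\ a * b = age G].
Proof.
rewrite /age; case: cid => e /= [_ e1 eU eV]; split=> [a|f fP|a].
- exact: e1.
- by apply: eU.
- by have [b [_ ba ab]] := eV a I; exists b.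
Qed.

(* Chosen among the two-sided inverses of a, of which there is only one by
   agmul_rcancel. *)
Definition aginv a : G := let: And3 _ _ eV := ageP in sval (cid (eV a)).

Lemma ag1mul a : age G * a = a.
Proof. by case: ageP. Qed.

Lemma agmulVK a : aginv a * a = age G /\ a * aginv a = age G.
Proof. by rewrite /aginv; case: ageP => ? ? eV; case: cid. Qed.

Lemma agmulV a : aginv a * a = age G. Proof. by case: (agmulVK a). Qed.
Lemma agmulKV a : a * aginv a = age G. Proof. by case: (agmulVK a). Qed.

Lemma agmul_left_invertive a b c : (a * b) * c = (c * b) * a.
Proof. exact: AGgroup_left_invertive (@agmulP G) _ _ _ I I I. Qed.

Lemma agmul_medial a b c d : (a * b) * (c * d) = (a * c) * (b * d).
Proof.
by rewrite agmul_left_invertive (agmul_left_invertive c d b)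
           agmul_left_invertive.
Qed.

Lemma agmul_rcancel a b c : a * c = b * c -> a = b.
Proof.
move=> /(congr1 (fun z => z * aginv c)).
by rewrite (agmul_left_invertive a) (agmul_left_invertive b) agmulV !ag1mul.
Qed.

End AGGroupTheory.

Record agSubgroup (G : agGroupType) := AGSubgroup {
  agset :> set G;
  agset_nonempty : agset !=set0;
  agsetP : AGgroup_on agmul agset }.

Definition agcoset (G : agGroupType) (H : set G) (x : G) : set G :=
  [set h * x | h in H].

(* The elements of G/H are the subsets Hx of G. *)
Definition agquotient (G : agGroupType) (H : agSubgroup G) : Type :=
  set_type (range (agcoset H)).

Section Quotient.
Variables (G : agGroupType) (H : agSubgroup G).

Definition agquo (x : G) : agquotient H :=
  SigSub (mem_set (imageT (agcoset H) x)).

Lemma agquo_ex (A : agquotient H) : exists x, A = agquo x.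
Proof.
have [x _ xA] := set_mem (valP A); exists x.
by apply: val_inj; rewrite /= -xA.
Qed.

Definition agrepr (A : agquotient H) : G := sval (cid (agquo_ex A)).

Lemma agreprK A : agquo (agrepr A) = A.
Proof. by rewrite /agrepr; case: cid. Qed.

(* (Hx)(Hy) = H(xy), computed on chosen representatives; agquo_mulE shows that
   the choice is irrelevant. *)
Definition agquo_mul (A B : agquotient H) : agquotient H :=
  agquo (agrepr A * agrepr B).

Lemma agset1 : agset H (age G).
Proof.
have [e [He e1 _ _]] := AGgroup_unit_inverse (agsetP H).
suff <- : e = age G by [].
by apply: (@agmul_rcancel _ _ _ e); rewrite ag1mul e1.
Qed.

Lemma agcoset_mul (x y : G) :
  agcoset H (x * y) = [set a * b | a in agcoset H x & b in agcoset H y].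
Proof.
apply/seteqP; split=> [_ [h Hh <-]|_ [_ [h Hh <-] [_ [k Hk <-] <-]]].
- exists (age G * x); first by exists (age G) => //; exact: agset1.
  by exists (h * y); [exists h | rewrite agmul_medial ag1mul].
- exists (h * k); last by rewrite agmul_medial.
  exact: (AGgroup_closed (agsetP H)).
Qed.

Lemma agquo_mulE (x y : G) : agquo_mul (agquo x) (agquo y) = agquo (x * y).
Proof.
apply: val_inj; rewrite /= !agcoset_mul.
by have /(congr1 val) /= -> := agreprK (agquo x);
   have /(congr1 val) /= -> := agreprK (agquo y).
Qed.

Lemma agquo_mulP : AGgroup_on agquo_mul [set: agquotient H].
Proof.
have left_inv A B C : agquo_mul (agquo_mul A B) C = agquo_mul (agquo_mul C B) A.
  rewrite -(agreprK A) -(agreprK B) -(agreprK C) !agquo_mulE.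
  by rewrite agmul_left_invertive.
have one_mul A : agquo_mul (agquo (age G)) A = A.
  by rewrite -(agreprK A) agquo_mulE ag1mul.
split=> //.
exists (agquo (age G)); split=> // [F _ F1|A _].
- rewrite -(agreprK F); set x := agrepr F.
  have := F1 (agquo x) I; rewrite -{1}(agreprK F) -/x => xx.
  have := congr1 (fun Z => agquo_mul Z (agquo (aginv x))) xx.
  by rewrite /= left_inv !agquo_mulE agmulV agmulKV ag1mul.
- exists (agquo (aginv (agrepr A))).
  split=> //; first by rewrite -{2}(agreprK A) agquo_mulE agmulV.
  by rewrite -{1}(agreprK A) agquo_mulE agmulKV.
Qed.

HB.instance Definition _ := isAGGroup.Build (agquotient H) agquo_mulP.

End Quotient.

Local Open Scope ring_scope.

Definition fuzzy_subset (R : realType) (X : Type) (mu : X -> R) : Prop :=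
  forall x, 0 <= mu x <= 1.

Record fuzzy_agsubgroup (R : realType) (K : agGroupType) (mu : K -> R) : Prop :=
  { fuzzy_agsubgroup_subset : fuzzy_subset mu;
    fuzzy_agsubgroup_mul : forall x y : K,
      Num.min (mu x) (mu y) <= mu (x * y)%AG;
    fuzzy_agsubgroup_inv : forall x : K, mu x <= mu (aginv x) }.

Definition fuzzy_quotient (R : realType) (G : agGroupType) (H : agSubgroup G)
    (nu : G -> R) (A : agquotient H) : R :=
  sup [set nu z | z in (val A : set G)].

Lemma fuzzy_quotientE (R : realType) (G : agGroupType) (H : agSubgroup G)
    (nu : G -> R) (x : G) :
  fuzzy_quotient nu (agquo H x) = sup [set nu z | z in agcoset H x].
Proof. by []. Qed.

(* Main.v *)
Require Import Defs.
From HB Require Import structures.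
From mathcomp Require Import all_boot all_order all_algebra.
From mathcomp Require Import all_classical all_reals.

(** The coset [H(xy)] is the set of products of [Hx] and [Hy], and
    [(hx)^-1 = h^-1 x^-1] by the medial law, so inversion maps [Hx] into
    [(Hx)^-1].  Hence [nu a /\ nu b <= nu (ab) <= xi (AB)] for [a] in [A] and
    [b] in [B], and likewise for inverses; both claims follow by passing to
    suprema. *)

Set Implicit Arguments.
Unset Strict Implicit.
Unset Printing Implicit Defensive.
Import Order.TTheory GRing.Theory Num.Theory.
Local Open Scope classical_set_scope.
Local Open Scope ring_scope.

(** By right cancellation any left inverse of [a] is the chosen one, so a single product suffices to
    identify [aginv a]. *)
Lemma aginv_eq (G : agGroupType) (a b : G) :
  agmul b a = age G -> aginv a = b.
Proof. by move=> ba; apply: (@agmul_rcancel _ _ _ a); rewrite agmulV. Qed.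

Lemma aginvM (G : agGroupType) (a b : G) :
  aginv (agmul a b) = agmul (aginv a) (aginv b).
Proof. by apply: aginv_eq; rewrite agmul_medial !agmulV ag1mul. Qed.

(** The left identity [e] of [H] is that of [G]: both fix [e] from the left, and [e] cancels on the
    right. An inverse found inside [H] is then the inverse in [G]. *)
Lemma agsetV (G : agGroupType) (H : agSubgroup G) (h : G) :
  agset H h -> agset H (aginv h).
Proof.
have [e [He e1 _ eV]] := AGgroup_unit_inverse (agsetP H).
have e_age : e = age G.
  by apply: (@agmul_rcancel _ _ _ e); rewrite ag1mul e1.
by move=> /eV[b [Hb bh _]]; rewrite (@aginv_eq _ h b) // bh.
Qed.

Lemma agquo_inv (G : agGroupType) (H : agSubgroup G) (x : G) :
  aginv (agquo H x) = agquo H (aginv x).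
Proof.
have quoM (y z : G) :
  agmul (agquo H y) (agquo H z) = agquo H (agmul y z) := agquo_mulE H y z.
apply: aginv_eq; rewrite quoM agmulV.
(* It remains to see that the class of [age G] is the left identity of the quotient: both fix
   [agquo H x] from the left. *)
by apply: (@agmul_rcancel _ _ _ (agquo H x)); rewrite quoM !ag1mul.
Qed.

Lemma agquotient_mem_mul (G : agGroupType) (H : agSubgroup G)
    (A B : agquotient H) (a b : G) :
  (val A : set G) a -> (val B : set G) b ->
  (val (agmul A B) : set G) (agmul a b).
Proof.
have [[x ->] [y ->]] := (agquo_ex A, agquo_ex B) => xa yb.
have -> : agmul (agquo H x) (agquo H y) = agquo H (agmul x y).
  exact: agquo_mulE.
by rewrite /= agcoset_mul; exists a => //; exists b.
Qed.

Lemma agquotient_mem_inv (G : agGroupType) (H : agSubgroup G)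
    (A : agquotient H) (a : G) :
  (val A : set G) a -> (val (aginv A) : set G) (aginv a).
Proof.
have [x ->] := agquo_ex A; rewrite agquo_inv => -[h Hh <-].
by exists (aginv h); [exact: agsetV | rewrite aginvM].
Qed.

Lemma agquotient_nonempty (G : agGroupType) (H : agSubgroup G)
    (A : agquotient H) : (val A : set G) !=set0.
Proof.
have [x ->] := agquo_ex A; have [h Hh] := agset_nonempty H.
by exists (agmul h x), h.
Qed.

Section FuzzyQuotient.
Variables (R : realType) (G : agGroupType) (H : agSubgroup G) (nu : G -> R).
Hypothesis nu01 : fuzzy_subset nu.
Implicit Types A : agquotient H.

Lemma fuzzy_quotient_ge A a : (val A : set G) a -> nu a <= fuzzy_quotient nu A.
Proof.
move=> Aa; apply: ub_le_sup; last by exists a.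
(* [sup] is known to dominate a set only when that set is bounded above; 1 bounds all values of
   [nu]. *)
by exists 1 => _ [z _ <-]; case/andP: (nu01 z).
Qed.

Lemma fuzzy_quotient_le A c :
  (forall a, (val A : set G) a -> nu a <= c) -> fuzzy_quotient nu A <= c.
Proof.
move=> Ac; apply: ge_sup; last by move=> _ [a Aa <-]; exact: Ac.
(* Nonemptiness matters: [sup] of the empty set is 0, which exceeds a negative [c]. *)
by have [a Aa] := agquotient_nonempty A; exists (nu a), a.
Qed.

(** The supremum need not be attained, so this witness replaces a maximizer of [nu] on the coset. *)
Lemma fuzzy_quotient_gt A c : c < fuzzy_quotient nu A ->
  exists2 a, (val A : set G) a & c < nu a.
Proof.
move=> cA; apply: contrapT => nA.
suff : fuzzy_quotient nu A <= c by rewrite leNgt cA.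
apply: fuzzy_quotient_le => a Aa; rewrite leNgt.
by apply/negP => ca; apply: nA; exists a.
Qed.

Lemma fuzzy_quotient_subset : fuzzy_subset (@fuzzy_quotient R G H nu).
Proof.
move=> A; have [a Aa] := agquotient_nonempty A; apply/andP; split.
  have /andP[nu_ge0 _] := nu01 a.
  exact: le_trans nu_ge0 (fuzzy_quotient_ge Aa).
by apply: fuzzy_quotient_le => z _; case/andP: (nu01 z).
Qed.

End FuzzyQuotient.

Theorem theorem3 (R : realType) (G : agGroupType) (nu : G -> R)
    (hnu : fuzzy_agsubgroup nu) (H : agSubgroup G) :
  fuzzy_agsubgroup (fuzzy_quotient (H := H) nu).
Proof.
have [nu01 nuM nuV] := hnu.
split=> [|A B|A]; first exact: fuzzy_quotient_subset.
(* By contradiction, with the value at the product coset as threshold: [a] and [b] both exceed it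
   under [nu], hence so does their product, which lies in that coset. *)
- rewrite leNgt; apply/negP; rewrite lt_min => /andP[].
  move=> /fuzzy_quotient_gt[a Aa lta] /fuzzy_quotient_gt[b Bb ltb].
  have := fuzzy_quotient_ge nu01 (agquotient_mem_mul Aa Bb).
  by rewrite leNgt (lt_le_trans _ (nuM a b)) // lt_min lta.
- apply: fuzzy_quotient_le => a Aa; apply: le_trans (nuV a) _.
  exact/fuzzy_quotient_ge/agquotient_mem_inv.
Qed.
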